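(* Let $G_n=\overline{C_n}$ be the graph complement of the cycle graph with $n$ vertices, and let $r(G)$ denote the forest-tree ratio of a finite simple graph $G$. Then $$\lim_{n\to\infty} r(G_n)=e,$$ where $e$ is the Euler number.
   Context: The Kirchhoff Laplacian of a finite simple graph is $K=B-A$, with $B$ the diagonal vertex degree matrix and $A$ the adjacency matrix. The forest-tree ratio is $r(G)=\det(1+K)/\mathrm{Det}(K)=\prod_{\lambda\neq 0}\left(1+\frac1\lambda\right)$, the product over the nonzero eigenvalues $\lambda$ of $K$ counted with multiplicity, where $\mathrm{Det}(K)$ is the product of the nonzero eigenvalues of $K$. (For connected $G$ this is the number of rooted spanning forests divided by the number of rooted spanning trees.) *)

(* Defs.v *)
From mathcomp Require Import all_boot all_order all_algebra.
From mathcomp Require Import polyrcf.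
From mathcomp Require Import reals.

Set Implicit Arguments.
Unset Strict Implicit.
Unset Printing Implicit Defensive.

Import Order.TTheory GRing.Theory Num.Theory.

Local Open Scope ring_scope.

Record sgraph (V : finType) := SGraph {
  adj :> rel V;
  adj_sym : symmetric adj;
  adj_irr : irreflexive adj }.

Section Complement.
Variables (V : finType) (G : sgraph V).

Definition compl_rel : rel V := fun x y => (x != y) && ~~ G x y.

Fact compl_rel_sym : symmetric compl_rel.
Proof. by move=> x y; rewrite /compl_rel eq_sym adj_sym. Qed.

Fact compl_rel_irr : irreflexive compl_rel.
Proof. by move=> x; rewrite /compl_rel eqxx. Qed.

Definition compl_graph : sgraph V := SGraph compl_rel_sym compl_rel_irr.
End Complement.

Section Cycle.
Variable n : nat.

(* The test x != y only matters for n = 1, where it removes the loop. For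
   n = 0, 1, 2 this is the graph with n vertices and 0, 0, 1 edges; from n = 3
   on it is the n-cycle. *)
Definition cycle_rel : rel 'I_n := fun x y =>
  (x != y) && ((y == x.+1 %% n :> nat)%N || (x == y.+1 %% n :> nat)%N).

Fact cycle_rel_sym : symmetric cycle_rel.
Proof. by move=> x y; rewrite /cycle_rel eq_sym orbC. Qed.

Fact cycle_rel_irr : irreflexive cycle_rel.
Proof. by move=> x; rewrite /cycle_rel eqxx. Qed.

Definition cycle_graph : sgraph 'I_n := SGraph cycle_rel_sym cycle_rel_irr.
End Cycle.

Section ForestTreeRatio.
Variable R : realType.

(* A symmetric real matrix has only real eigenvalues, so for such M the real
   roots of the characteristic polynomial are all the eigenvalues; rootsR lists
   each of them once, hence the exponent. *)
Definition pseudo_det (m : nat) (M : 'M[R]_m) : R :=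
  \prod_(a <- rootsR (char_poly M) | a != 0) a ^+ mup a (char_poly M).

Variables (V : finType) (G : sgraph V).

Definition degree (x : V) : nat := #|[pred y | G x y]|.

Definition adjacency_mx : 'M[R]_#|V| :=
  \matrix_(i, j) (G (enum_val i) (enum_val j))%:R.

Definition degree_mx : 'M[R]_#|V| :=
  diag_mx (\row_i (degree (enum_val i))%:R).

Definition kirchhoff_mx : 'M[R]_#|V| := degree_mx - adjacency_mx.

Definition forest_tree_ratio : R :=
  \det (1%:M + kirchhoff_mx) / pseudo_det kirchhoff_mx.
End ForestTreeRatio.

(* Main.v *)
Require Import Defs.
From mathcomp Require Import all_boot all_order all_algebra.
From mathcomp Require Import cyclic separable cyclotomic polyrcf complex.
From mathcomp Require Import all_classical all_reals all_analysis.
From mathcomp Require Import ring lra zify.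
Import Order.TTheory GRing.Theory Num.Theory.
Import numFieldNormedType.Exports.
Local Open Scope classical_set_scope.
Local Open Scope ring_scope.

Set Implicit Arguments.
Unset Strict Implicit.
Unset Printing Implicit Defensive.

(** On a graph with [n] vertices, a function whose values sum to [0] and which
    is a Laplacian eigenfunction of [G] for the eigenvalue [mu] is one of the
    complement for the eigenvalue [n - mu] ([laplacian_compl]).  The characters
    [y |-> w ^+ (j * y)] of Z/n, where [w] is a primitive [n]-th root of unity,
    form an eigenbasis for the cycle, so they form one for its complement.
    There the constant character has eigenvalue [0], and for [j != 0] the
    eigenvalue is [n - 2 + w ^+ j + w ^- j = n - 2 + 2 Re (w ^+ j)], which lies
    in [[n - 4, n]] because [w ^+ j] has modulus [1].

    Consequently the forest-tree ratio is a product of [n - 1] factors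
    [1 + 1 / a] with [n - 4 <= a <= n].  The explicit eigenvalues are not used
    beyond these bounds: from [1 + x <= exp x] one gets
    [exp (1 / (n + 1)) <= 1 + 1 / a <= exp (1 / (n - 4))]
    ([inv1D_expR_bounds]), so that the ratio lies between
    [exp ((n - 1) / (n + 1))] and [exp ((n - 1) / (n - 4))], and both of these
    tend to [exp 1].

    The ratio itself is defined from the real roots of the characteristic
    polynomial.  As the eigenbasis is complex, the factorization of that
    polynomial is established over R[i] and descends to R because all its roots
    are real ([kirchhoff_eigenbasis]). *)

(** * The forest-tree ratio of a split characteristic polynomial *)

Lemma mup_prod_XsubC (F : fieldType) (x : F) (s : seq F) :
  mup x (\prod_(a <- s) ('X - a%:P)) = count_mem x s.
Proof.
elim: s => [|a s IHs]; first by rewrite big_nil mupNroot // root1.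
rewrite big_cons mupM ?polyXsubC_eq0 ?monic_neq0 ?monic_prod_XsubC //.
by rewrite IHs /= -[X in mup _ X]expr1 mup_XsubCX eq_sym; case: eqP.
Qed.

Lemma pseudo_det_split (R : realType) (m : nat) (M : 'M[R]_m) (s : seq R) :
  char_poly M = \prod_(a <- s) ('X - a%:P) ->
  pseudo_det M = \prod_(a <- s | a != 0) a.
Proof.
move=> pM; rewrite /pseudo_det.
have p0 : char_poly M != 0 by rewrite monic_neq0 ?char_poly_monic.
have rootsE : perm_eq (rootsR (char_poly M)) (undup s).
  rewrite uniq_perm ?undup_uniq ?uniq_roots // => x.
  have := roots_on_rootsR p0 x; rewrite in_itv /= => <-.
  by rewrite mem_undup pM root_prod_XsubC.
rewrite (perm_big _ rootsE) /= -[RHS]big_undup_iterop_count.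
by apply: eq_bigr => a _; rewrite pM mup_prod_XsubC.
Qed.

(** The determinant is, up to the sign [(-1) ^+ m], the value of the
    characteristic polynomial at [-1]. *)
Lemma det_1D_split (F : fieldType) (m : nat) (M : 'M[F]_m) (s : seq F) :
  char_poly M = \prod_(a <- s) ('X - a%:P) ->
  \det (1%:M + M) = \prod_(a <- s) (1 + a).
Proof.
move=> pM; have szs : size s = m.
  by apply: succn_inj; rewrite -(size_char_poly M) pM size_prod_XsubC.
have det_horner : (char_poly M).[-1] = (-1) ^+ m * \det (1%:M + M).
  rewrite -detZ /char_poly -[LHS]/(horner_eval (-1) _) -det_map_mx.
  congr (\det _); apply/matrixP=> i j.
  rewrite !mxE /= /horner_eval hornerD hornerN hornerC hornerMn hornerX.
  by case: (i == j); rewrite /= ?mulr1n ?mulr0n; ring.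
apply: (@mulfI _ ((-1) ^+ m)); first by rewrite signr_eq0.
rewrite -det_horner pM horner_prod -szs.
elim: (s) => [|a t IHt]; first by rewrite !big_nil mulr1.
by rewrite !big_cons IHt /= exprS hornerXsubC; ring.
Qed.

(** Zero eigenvalues contribute the factor [1] to the numerator. *)
Lemma forest_tree_ratio_split (R : realType) (V : finType) (G : sgraph V)
    (s : seq R) :
  char_poly (kirchhoff_mx R G) = \prod_(a <- s) ('X - a%:P) ->
  forest_tree_ratio R G = \prod_(a <- s | a != 0) (1 + a^-1).
Proof.
move=> pK; rewrite /forest_tree_ratio (det_1D_split pK).
rewrite (pseudo_det_split pK) (bigID (fun a => a != 0)) /=.
rewrite [X in _ * X / _]big1 ?mulr1 => [|a /negPn/eqP ->]; last by rewrite addr0.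
by rewrite -prodf_div; apply: eq_bigr => a a0; rewrite mulrDl mul1r divff // addrC.
Qed.

(** The columns of [P] are eigenvectors of [M].  Since
    [('X - M) P = P ('X - diag d)], comparing determinants over the polynomial
    ring and cancelling [\det P] avoids any inverse of [P]. *)
Lemma char_poly_eigenbasis (F : fieldType) (m : nat) (M P : 'M[F]_m)
    (d : 'rV[F]_m) :
  \det P != 0 -> M *m P = P *m diag_mx d ->
  char_poly M = \prod_(i < m) ('X - (d 0 i)%:P).
Proof.
move=> P0 MP; have -> : \prod_(i < m) ('X - (d 0 i)%:P) = char_poly (diag_mx d).
  rewrite char_poly_trig ?diag_mx_is_trig //.
  by apply: eq_bigr => i _; rewrite mxE eqxx mulr1n.
apply: (@mulIf _ (\det (map_mx polyC P))); first by rewrite det_map_mx polyC_eq0.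
rewrite [RHS]mulrC -!det_mulmx; congr (\det _).
by rewrite /char_poly_mx mulmxBl mulmxBr -!map_mxM MP scalar_mxC.
Qed.

(** * The Laplacian as an operator on functions *)

(** The Kirchhoff matrix acting on functions with values in any abelian group:
    it needs no enumeration of the vertices, and complex eigenfunctions of the
    real matrix can be stated with it. *)
Definition laplacian (V : finType) (U : zmodType) (G : sgraph V)
  (f : V -> U) (x : V) : U := \sum_(y | G x y) (f x - f y).

(** The eigenfunctions may live in an extension [C] of [R] as long as the
    eigenvalues come from [R]: field morphisms are injective on polynomials. *)
Lemma kirchhoff_eigenbasis (R : realType) (C : fieldType)
    (phi : {rmorphism R -> C}) (V : finType) (G : sgraph V)
    (f : V -> V -> C) (d : V -> R) :
  \det (\matrix_(i < #|V|, j < #|V|) f (enum_val j) (enum_val i)) != 0 ->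
  (forall j x, laplacian G (f j) x = phi (d j) * f j x) ->
  char_poly (kirchhoff_mx R G) = \prod_(j : V) ('X - (d j)%:P).
Proof.
move=> det0 eig; apply: (map_poly_inj phi).
rewrite map_char_poly (@char_poly_eigenbasis _ _ _ _
  (\row_j phi (d (enum_val j))) det0).
  rewrite rmorph_prod (reindex (@enum_val V V)) /=; last exact/onW_bij/enum_val_bij.
  by apply: eq_bigr => j _; rewrite mxE rmorphB /= map_polyX map_polyC.
apply/matrixP=> i j; rewrite mul_mx_diag !mxE [RHS]mulrC -eig /laplacian.
set g := f (enum_val j); set x := enum_val i.
transitivity (\sum_(k < #|V|) ((phi (degree G x)%:R * g x) *+ (k == i) -
    if G x (enum_val k) then g (enum_val k) else 0)).
  apply: eq_bigr => k _; rewrite !mxE -/x -/g rmorphB mulrBl eq_sym.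
  congr (_ - _); last by case: (G _ _); rewrite ?rmorph1 ?rmorph0 ?mul1r ?mul0r.
  by have [->|_] := eqVneq k i; rewrite ?mulr1n ?mulr0n ?rmorph0 ?mul0r.
rewrite !sumrB -big_mkcond [in RHS]sumr_const; congr (_ - _).
  rewrite (bigD1 i) //= eqxx big1 ?addr0 => [|k /negPf -> //].
  by rewrite rmorph_nat mulr_natl.
by rewrite [RHS](reindex (@enum_val V V)) //; exact/onW_bij/enum_val_bij.
Qed.

(** Summing [f x - f y] over all vertices [y] splits into the neighbours of [x]
    in [G] and those in the complement. *)
Lemma laplacian_compl (V : finType) (U : zmodType) (G : sgraph V)
    (f : V -> U) (x : V) :
  laplacian (compl_graph G) f x =
    f x *+ #|V| - \sum_y f y - laplacian G f x.
Proof.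
rewrite -[f x *+ _]sumr_const -sumrB /laplacian.
rewrite [\sum_(i in V) _](bigD1 x) //= subrr add0r.
rewrite [in RHS](bigID (G x)) /= addrAC [X in _ = X - _ + _](eq_bigl (G x)).
  by rewrite subrr add0r; apply: eq_bigl => y; rewrite /compl_rel eq_sym.
by move=> y; case: eqVneq => [->|_]; rewrite ?adj_irr.
Qed.

(** At least three vertices are needed for the two neighbours of [x] to be
    distinct. *)
Lemma laplacian_cycle (n : nat) (U : zmodType) (f : 'I_n -> U) (x : 'I_n) :
  (2 < n)%N ->
  laplacian (cycle_graph n) f x =
    f x *+ 2 - f (ordS x) - f (ord_pred x).
Proof.
move=> n_gt2.
have ordS_neq (z : 'I_n) : z != ordS z.
  rewrite -val_eqE /=; have := ltn_ord z; rewrite leq_eqVlt => /orP[/eqP zn|zn].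
    by rewrite zn modnn; lia.
  by rewrite modn_small //; lia.
have ordSS_neq (z : 'I_n) : z != ordS (ordS z).
  rewrite -val_eqE /= -addn1 modnDml addn1.
  have [zn|zn] := ltnP z.+2 n; first by rewrite modn_small //; lia.
  rewrite -(subnK zn) modnDr modn_small; have := ltn_ord z; lia.
have predE (y z : 'I_n) : (y == ord_pred z) = (z == ordS y).
  by rewrite -(inj_eq (@ordS_inj n) y) ord_predK eq_sym.
have adjE y : cycle_graph n x y = (y == ordS x) || (y == ord_pred x).
  rewrite predE -[LHS]/((x != y) && ((y == ordS x) || (x == ordS y))).
  by case: eqVneq => [<-|//]; rewrite (negPf (ordS_neq x)).
rewrite /laplacian (eq_bigl _ _ adjE) (bigD1 (ordS x)) /= ?eqxx //.
rewrite (big_pred1 (ord_pred x)) => [|y /=].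
  by rewrite addrACA addrA mulr2n.
have [->|_] := eqVneq y (ordS x); rewrite ?andbT ?andbF //=.
by rewrite predE (negPf (ordSS_neq x)).
Qed.

(** * Roots of unity *)

(** Separability of ['X^n - 1] provides [n] distinct roots, and a field with
    that many [n]-th roots of unity has a primitive one. *)
Lemma closed_prim_root_exists (F : closedFieldType) (n : nat) :
  (n%:R : F) != 0 -> exists z : F, n.-primitive_root z.
Proof.
move=> n0; have n_gt0 : (0 < n)%N by case: n n0 => //; rewrite eqxx.
have [r] := closed_field_poly_normal ('X^n - 1 : {poly F}).
rewrite (monicP _) ?monicXnsubC // scale1r => Dp.
have rn1 : all n.-unity_root r by apply/allP=> z; rewrite -root_prod_XsubC -Dp.
have sz_r : (n < (size r).+1)%N.
  by rewrite -(size_prod_XsubC r id) -Dp size_XnsubC.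
have [|z] := hasP (has_prim_root n_gt0 rn1 _ sz_r); last by exists z.
by rewrite -separable_prod_XsubC -Dp separable_Xn_sub_1.
Qed.

Lemma sum_powers_unity_root (F : fieldType) (n : nat) (z : F) :
  z ^+ n = 1 -> z != 1 -> \sum_(i < n) z ^+ i = 0.
Proof.
move=> zn1 z1; apply: (@mulfI _ (z - 1)); first by rewrite subr_eq0.
by rewrite -subrX1 zn1 subrr mulr0.
Qed.

Lemma norm_unity_root (F : numDomainType) (n : nat) (z : F) :
  (0 < n)%N -> z ^+ n = 1 -> `|z| = 1.
Proof.
move=> n_gt0 zn1.
by apply/eqP; rewrite -(pexpr_eq1 n_gt0) // -normrX zn1 normr1.
Qed.

(** On the unit circle the inverse is the conjugate. *)
Lemma unity_root_addV (R : rcfType) (n : nat) (z : R[i]) :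
  (0 < n)%N -> z ^+ n = 1 -> z + z^-1 = real_complex R (2 * complex.Re z).
Proof.
move=> n_gt0 zn1.
by rewrite invc_norm (norm_unity_root n_gt0 zn1) expr1n invr1 mul1r addcJ rmorphM rmorph_nat.
Qed.

Lemma unity_root_Re (R : rcfType) (n : nat) (z : R[i]) :
  (0 < n)%N -> z ^+ n = 1 -> `|complex.Re z| <= 1.
Proof.
move=> n_gt0 zn1.
by rewrite -lecR (le_trans (normc_ge_Re z)) // (norm_unity_root n_gt0 zn1).
Qed.

(** * The spectrum of the complement of a cycle *)

(** The Fourier matrix is the Vandermonde matrix of the distinct powers of
    [w]. *)
Lemma dft_unit (F : fieldType) (n : nat) (w : F) :
  n.-primitive_root w ->
  \det (\matrix_(i < #|'I_n|, j < #|'I_n|)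
          w ^+ (val (enum_val j) * val (enum_val i))) != 0.
Proof.
move=> w_prim; pose a : 'rV[F]_#|'I_n| := \row_j w ^+ (val (enum_val j)).
rewrite (_ : (\matrix_(i, j) _) = Vandermonde #|'I_n| a); last first.
  by apply/matrixP=> i j; rewrite !mxE exprM !enum_val_ord.
rewrite det_Vandermonde; apply/prodf_neq0 => i _; apply/prodf_neq0 => j lt_ij.
rewrite !mxE subr_eq0 (eq_prim_root_expr w_prim).
rewrite !(modn_small (ltn_ord (enum_val _))).
by rewrite !enum_val_ord /= gtn_eqF.
Qed.

(** The eigenvalue of the complement of the [n]-cycle on the [j]-th character.
    At [j = 0] the general formula would give [n]: the constant character is the
    one whose values do not sum to [0]. *)
Definition cocycle_eigenvalue (R : rcfType) (n : nat) (w : R[i]) (j : 'I_n) : R :=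
  if val j == 0%N then 0 else n%:R - 2 + 2 * complex.Re (w ^+ j).

(** Going around the cycle multiplies the [j]-th character by [w ^+ j], so the
    cycle has eigenvalue [2 - w ^+ j - w ^- j] on it; for [j != 0] its values
    sum to [0] and passing to the complement turns this into [n] minus that
    eigenvalue. *)
Lemma cocycle_eigenvector (R : realType) (n : nat) (w : R[i]) (j x : 'I_n) :
  (2 < n)%N -> n.-primitive_root w ->
  laplacian (compl_graph (cycle_graph n)) (fun y : 'I_n => w ^+ (j * y)) x =
    real_complex R (cocycle_eigenvalue w j) * w ^+ (j * x).
Proof.
move=> n_gt2 w_prim; have n_gt0 : (0 < n)%N by apply: ltn_trans n_gt2.
rewrite /cocycle_eigenvalue; case: eqVneq => [->|j0].
  rewrite rmorph0 mul0r /laplacian big1 // => y _.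
  by rewrite !mul0n subrr.
have w0 : w != 0 by rewrite (prim_root_eq0 w_prim) -lt0n.
set z := w ^+ j; have z0 : z != 0 by rewrite expf_neq0.
have zn1 : z ^+ n = 1 by rewrite -exprM mulnC exprM (prim_expr_order w_prim) expr1n.
have z1 : z != 1.
  rewrite -(expr0 w) (eq_prim_root_expr w_prim) mod0n.
  by rewrite modn_small.
have sum0 : \sum_(y < n) w ^+ (j * y) = 0.
  rewrite -[RHS](sum_powers_unity_root zn1 z1).
  by apply: eq_bigr => y _; rewrite exprM.
have shift (y : 'I_n) : w ^+ (j * ordS y) = z * w ^+ (j * y).
  by rewrite !exprM -/z -exprS /= (expr_mod _ zn1).
rewrite laplacian_compl laplacian_cycle // sum0 subr0 card_ord shift.
have -> : w ^+ (j * ord_pred x) = z^-1 * w ^+ (j * x).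
  by rewrite -[in RHS](ord_predK x) shift mulKf.
have -> : real_complex R (n%:R - 2 + 2 * complex.Re z) = n%:R - 2 + (z + z^-1).
  by rewrite (unity_root_addV n_gt0 zn1) !(rmorphD, rmorphN) !rmorph_nat.
by rewrite -[_ *+ n]mulr_natl; ring.
Qed.

Lemma char_poly_cocycle (R : realType) (n : nat) (w : R[i]) :
  (2 < n)%N -> n.-primitive_root w ->
  char_poly (kirchhoff_mx R (compl_graph (cycle_graph n))) =
    \prod_(j < n) ('X - (cocycle_eigenvalue w j)%:P).
Proof.
move=> n_gt2 w_prim.
apply: (@kirchhoff_eigenbasis R R[i] (real_complex R) _ _
  (fun j y : 'I_n => w ^+ (j * y)) (cocycle_eigenvalue w)).
  exact: dft_unit.
by move=> j x; exact: cocycle_eigenvector.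
Qed.

(** * Bounds and limit *)

(** The lower bound uses [1 + 1 / a = (1 - 1 / (a + 1))^-1] and
    [1 - x <= exp (- x)]. *)
Lemma inv1D_expR_bounds (R : realType) (b a c : R) :
  0 < b -> b <= a <= c ->
  expR (c + 1)^-1 <= 1 + a^-1 <= expR b^-1.
Proof.
move=> b0 /andP[ba ac]; have a0 := lt_le_trans b0 ba.
apply/andP; split; last first.
  by apply: le_trans (expR_ge1Dx _); rewrite lerD2l lef_pV2 ?posrE.
apply: (@le_trans _ _ (expR (a + 1)^-1)).
  by rewrite ler_expR lef_pV2 ?posrE ?addr_gt0 ?lerD2r // (lt_le_trans a0).
have -> : 1 + a^-1 = (1 - (a + 1)^-1)^-1.
  by field; rewrite addrK; lra.
rewrite -[expR _]invrK -expRN lef_pV2 ?posrE ?expR_gt0 ?expR_ge1Dx //.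
by rewrite subr_gt0 invf_lt1; lra.
Qed.

Lemma cocycle_eigenvalue_bounds (R : rcfType) (n : nat) (w : R[i]) (j : 'I_n) :
  n.-primitive_root w -> val j != 0%N ->
  n%:R - 4 <= cocycle_eigenvalue w j <= n%:R.
Proof.
move=> w_prim j0; rewrite /cocycle_eigenvalue (negPf j0).
have n_gt0 := prim_order_gt0 w_prim.
have : `|complex.Re (w ^+ j)| <= 1.
  by apply: (unity_root_Re n_gt0); rewrite exprAC (prim_expr_order w_prim) expr1n.
by rewrite ler_norml => /andP[? ?]; lra.
Qed.

(** At least five vertices are taken so that the lower bound on the eigenvalues
    at nonzero indices, the number of vertices minus [4], is positive: exactly
    the index [0] then drops out of the product. *)
Lemma forest_tree_ratio_cocycle_bounds (R : realType) (n : nat) :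
  expR ((n%:R + 4) / (n%:R + 6) : R) <=
    forest_tree_ratio R (compl_graph (cycle_graph (n + 5))) <=
  expR ((n%:R + 4) / (n%:R + 1)).
Proof.
have [|w w_prim] := @closed_prim_root_exists R[i] (n + 5).
  by rewrite pnatr_eq0 addnS.
have n_gt2 : (2 < n + 5)%N by lia.
pose d := @cocycle_eigenvalue R (n + 5) w.
have ratioE : forest_tree_ratio R (compl_graph (cycle_graph (n + 5))) =
    \prod_(j < n + 5 | d j != 0) (1 + (d j)^-1).
  rewrite (@forest_tree_ratio_split _ _ _ [seq d j | j : 'I_(n + 5)]).
    by rewrite big_map big_enum_cond.
  by rewrite (char_poly_cocycle n_gt2 w_prim) big_map big_enum.
have d_bounds (j : 'I_(n + 5)) : val j != 0%N -> n%:R + 1 <= d j <= n%:R + 5.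
  move=> /(cocycle_eigenvalue_bounds w_prim); rewrite -/d natrD.
  by move=> /andP[? ?]; lra.
have n0 : 0 <= n%:R :> R by [].
have dE (j : 'I_(n + 5)) : (d j != 0) = (val j != 0%N).
  have [j0|j0] := eqVneq (val j) 0%N; first by rewrite /d /cocycle_eigenvalue j0 /= eqxx.
  by rewrite gt_eqF //; have /andP[? _] := d_bounds _ j0; lra.
have card_nz : #|[pred j : 'I_(n + 5) | val j != 0%N]| = (n + 4)%N.
  have z_lt : (0 < n + 5)%N by lia.
  have cardE : #|'I_(n + 5)|.-1 = (n + 4)%N by rewrite card_ord addnS.
  by rewrite -cardE; exact: (cardC1 (Ordinal z_lt)).
rewrite ratioE (eq_bigl _ _ dE).
(* The exponential bounds are spread over the same [n + 4] indices as the
   product, so that they can be compared factor by factor. *)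
have expR_prod (x : R) : expR ((n%:R + 4) * x) =
    \prod_(j < n + 5 | val j != 0%N) expR x.
  by rewrite prodr_const card_nz -expRM_natl natrD.
rewrite !expR_prod.
have fac_bounds (j : 'I_(n + 5)) : val j != 0%N ->
    expR (n%:R + 6)^-1 <= 1 + (d j)^-1 <= expR (n%:R + 1)^-1.
  move=> j0; rewrite (_ : n%:R + 6 = n%:R + 5 + 1); last by ring.
  by apply: inv1D_expR_bounds; [lra | exact: d_bounds].
apply/andP; split; apply: ler_prod => j /fac_bounds /andP[lo hi].
  by rewrite expR_ge0 lo.
by rewrite hi andbT (le_trans _ lo) ?expR_ge0.
Qed.

Lemma cvg_expR_ratio (R : realType) (a : R) (k : nat) :
  expR ((n%:R + a) / (n%:R + k.+1%:R)) @[n --> \oo] --> expR (1 : R).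
Proof.
apply: continuous_cvg; first exact: continuous_expR.
have -> : (fun n : nat => (n%:R + a) / (n%:R + k.+1%:R)) =
    (fun n => 1 + (a - k.+1%:R) * @harmonic R (n + k)).
  apply/funext => n; rewrite /harmonic /= -addnS natrD; field.
  by rewrite nat1r -natrD pnatr_eq0 addnS.
rewrite -[X in _ --> X]addr0 -[X in _ --> _ + X](mulr0 (a - k.+1%:R)).
apply: cvgD; first exact: cvg_cst.
apply: cvgM; first exact: cvg_cst.
by rewrite (cvg_shiftn k (@harmonic R)); exact: cvg_harmonic.
Qed.

Theorem theorem5 (R : realType) :
  (fun n : nat => forest_tree_ratio R (compl_graph (cycle_graph n))) @ \oo
    --> (expR 1 : R).
Proof.
rewrite -(cvg_shiftn 5).
apply: squeeze_cvgr.
- by apply: nearW => n; exact: forest_tree_ratio_cocycle_bounds.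
- exact: (@cvg_expR_ratio R 4 5).
- exact: (@cvg_expR_ratio R 4 0).
Qed.
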